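(* Let $\lambda=(\lambda_1,\dots,\lambda_I)$, $\mu=(\mu_1,\dots,\mu_J)$ be partitions of $n$, and let $\tau_{FY},\tau_{FY}^M,\tau_U,\tau_U^M$ be the relaxation times of the Markov chains $P_{FY},P_{FY}^M,P_U,P_U^M$ on $\mathcal{T}_{\lambda,\mu}$ defined in the context. Then (a) $\displaystyle\frac{m_{\lambda,\mu}^2(IJ)^2}{n^2}\tau_U^M\le\tau_U\le\frac{M_{\lambda,\mu}^2(IJ)^2}{n^2}\tau_U^M$; (b) $\displaystyle\frac{n^2}{(IJ)^2M_{\lambda,\mu}^4}\tau_{FY}^M\le\tau_{FY}\le\frac{n^2}{(IJ)^2m_{\lambda,\mu}^4}\tau_{FY}^M$. Moreover $m_{\lambda,\mu}\ge1$ and $M_{\lambda,\mu}\le\max_{i,j}\max(\lambda_i,\mu_j)$.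
   Context: $\mathcal{T}_{\lambda,\mu}$ is the set of $I\times J$ nonnegative integer tables $\mathbf{x}=(x_{ij})$ with row sums $\lambda_i$ and column sums $\mu_j$. For $i_1\ne i_2$, $j_1\ne j_2$, $F_{(i_1,j_1),(i_2,j_2)}(\mathbf{x})$ subtracts $1$ at $(i_1,j_1),(i_2,j_2)$ and adds $1$ at $(i_1,j_2),(i_2,j_1)$. $\pi_{FY}(\mathbf{x})=\frac1{n!}\prod_{i,j}\frac{\lambda_i!\mu_j!}{x_{ij}!}$ is the Fisher–Yates distribution. $P_{FY}$: $P_{FY}(\mathbf{x},\mathbf{y})=2x_{i_1j_1}x_{i_2j_2}/n^2$ if $\mathbf{y}=F_{(i_1,j_1),(i_2,j_2)}(\mathbf{x})\ne\mathbf{x}$, remaining mass on $\mathbf{x}$ (stationary distribution $\pi_{FY}$). $P_U$: $P_U(\mathbf{x},\mathbf{y})=2/(IJ)^2$ if $\mathbf{y}=F_{(i_1,j_1),(i_2,j_2)}(\mathbf{x})\in\mathcal{T}_{\lambda,\mu}$, $\mathbf{y}\neq\mathbf{x}$, remaining mass on $\mathbf{x}$ (uniform stationary distribution). $P_U^M$ is the Metropolis chain with proposal $P_{FY}$ and target the uniform distribution: $P_U^M(\mathbf{x},\mathbf{y})=\min(P_{FY}(\mathbf{x},\mathbf{y}),P_{FY}(\mathbf{y},\mathbf{x}))$ for $\mathbf{y}\ne\mathbf{x}$. $P_{FY}^M$ is the Metropolis chain with proposal $P_U$ and target $\pi_{FY}$: $P_{FY}^M(\mathbf{x},\mathbf{y})=P_U(\mathbf{x},\mathbf{y})\min\left(1,\frac{\pi_{FY}(\mathbf{y})}{\pi_{FY}(\mathbf{x})}\right)$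 for $\mathbf{y}\ne\mathbf{x}$; in both Metropolis chains the rejected mass stays at $\mathbf{x}$. The relaxation time of a reversible chain is $\tau=1/\gamma$ with $\gamma=1-\beta_2$ the spectral gap ($\beta_2$ the second largest eigenvalue). $m_{\lambda,\mu}=\min\{x_{ij}>0:\mathbf{x}\in\mathcal{T}_{\lambda,\mu}\}$ and $M_{\lambda,\mu}=\max\{x_{ij}:\mathbf{x}\in\mathcal{T}_{\lambda,\mu}\}$ (minimum positive entry and maximum entry over all tables). *)

(* Defs.v *)
From HB Require Import structures.
From mathcomp Require Import all_boot all_order all_algebra.
From mathcomp Require Import reals.
Set Implicit Arguments. Unset Strict Implicit. Unset Printing Implicit Defensive.
Import Order.TTheory GRing.Theory Num.Theory.
Local Open Scope ring_scope.

(* Contingency tables with margins lam (rows) and mu (columns).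
   Entries of a table in T_{lam,mu} are at most n, so we store them in 'I_n.+1. *)
Section Tables.
Variables (I J n : nat) (lam : 'I_I -> nat) (mu : 'I_J -> nat).

Definition cell := ('I_I * 'I_J)%type.
Definition tab := {ffun cell -> 'I_n.+1}.

Definition is_table (x : tab) : bool :=
  [forall i : 'I_I, \sum_(j < J) (x (i, j) : nat) == lam i] &&
  [forall j : 'I_J, \sum_(i < I) (x (i, j) : nat) == mu j].

Definition table := {x : tab | is_table x}.

Definition entry (x : table) (c : cell) : nat := val x c.

(* y = F_{(i1,j1),(i2,j2)}(x) : subtract 1 at (i1,j1),(i2,j2), add 1 at
   (i1,j2),(i2,j1); stated without subtraction (exact in nat). *)
Definition is_move (x y : table) (c1 c2 : cell) : bool :=
  [&& c1.1 != c2.1, c1.2 != c2.2 &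
  [forall c : cell,
     entry y c + (c == c1) + (c == c2) ==
     entry x c + (c == (c1.1, c2.2)) + (c == (c2.1, c1.2))]].

Variable R : realType.

(* off-diagonal entries: sum over ordered pairs of cells ((i1,j1),(i2,j2));
   each y = F(x) /= x arises from exactly two ordered pairs, which gives the
   factor 2 of the paper. *)
Definition PFY_off (x y : table) : R :=
  \sum_(c1 : cell) \sum_(c2 : cell | is_move x y c1 c2)
     ((entry x c1 * entry x c2)%:R / (n%:R ^+ 2)).

Definition PU_off (x y : table) : R :=
  \sum_(c1 : cell) \sum_(c2 : cell | is_move x y c1 c2)
     (1 / ((I * J)%:R ^+ 2)).

Definition piFY (x : table) : R :=
  (\prod_(i < I) (lam i)`!%:R) * (\prod_(j < J) (mu j)`!%:R) /
  ((n`!)%:R * \prod_(c : cell) (entry x c)`!%:R).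

Definition PUM_off (x y : table) : R := Num.min (PFY_off x y) (PFY_off y x).

Definition PFYM_off (x y : table) : R :=
  PU_off x y * Num.min 1 (piFY y / piFY x).

Definition kernel (off : table -> table -> R) (x y : table) : R :=
  if x == y then 1 - \sum_(z : table | z != x) off x z else off x y.

Definition P_FY := kernel PFY_off.
Definition P_U := kernel PU_off.
Definition P_UM := kernel PUM_off.
Definition P_FYM := kernel PFYM_off.

Definition chain_mx (P : table -> table -> R) : 'M[R]_#|{: table}| :=
  \matrix_(a, b) P (enum_val a) (enum_val b).

Definition m_lm : nat :=
  \big[minn/n]_(x : table) \big[minn/n]_(c : cell | (0 < entry x c)%N) entry x c.
Definition M_lm : nat := \max_(x : table) \max_(c : cell) entry x c.

End Tables.

Definition second_eigenvalue (R : realType) (k : nat) (A : 'M[R]_k) (b : R) : Prop :=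
  exists s : seq R,
    [/\ char_poly A = \prod_(r <- s) ('X - r%:P), sorted >=%R s & nth 0 s 1 = b].

Definition relaxation_time (R : realType) (k : nat) (A : 'M[R]_k) (t : R) : Prop :=
  exists b, second_eigenvalue A b /\ t = (1 - b)^-1.

Definition is_partition (k n : nat) (p : 'I_k -> nat) : Prop :=
  [/\ \sum_(i < k) p i = n, forall i, (0 < p i)%N & forall i i' : 'I_k, (i <= i')%N -> (p i' <= p i)%N].

(* Main.v *)
Require Import Defs.
From HB Require Import structures.
From mathcomp Require Import all_boot all_order all_algebra.
From mathcomp Require Import perm reals.
From mathcomp Require Import complex spectral.

(* The two chains in each of (a) and (b) are reversible for the same measure and
   move between the same pairs of tables, so it suffices to compare their
   off-diagonal rates: these bound each Dirichlet form by the other, and hence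
   the spectral gaps.  In (a) the rates are [2 / (IJ)^2] and the minimum of two
   products of two positive entries times [2 / n^2].  In (b), writing [p] and [q]
   for the products of the entries decreased by the move and by its inverse, one
   has [pi(y) / pi(x) = p / q], so the ratio of the rates is
   [max(p, q) (IJ)^2 / n^2]. *)

Set Implicit Arguments. Unset Strict Implicit. Unset Printing Implicit Defensive.
Import Order.TTheory GRing.Theory Num.Theory.
Local Open Scope ring_scope.
Local Open Scope sesquilinear_scope.

(** * Spectral decomposition of reversible matrices *)

Lemma char_poly_intertwine (K : fieldType) (n : nat) (A B F : 'M[K]_n) :
  F \in unitmx -> A *m F = F *m B -> char_poly A = char_poly B.
Proof.
move=> uF AF.
have E : char_poly_mx A *m map_mx polyC F = map_mx polyC F *m char_poly_mx B.
  by rewrite /char_poly_mx mulmxBl mulmxBr -!map_mxM AF scalar_mxC.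
have := congr1 determinant E; rewrite !det_mulmx [RHS]mulrC; apply: mulIf.
by rewrite det_map_mx polyC_eq0 -unitfE -unitmxE.
Qed.

Section Reversible.
Variables (C : numClosedFieldType) (n : nat) (w : 'I_n -> C).
Hypothesis w_gt0 : forall i, 0 < w i.

Definition reversible (A : 'M[C]_n) := forall i j, w i * A i j = w j * A j i.

(** The eigenvectors are the columns of [F], listed in the order of [s], so that for sorted [s]
    column 1 belongs to the second largest eigenvalue. *)
Definition eigenbasis (A : 'M[C]_n) (s : seq C) (F : 'M[C]_n) :=
  (forall i j, \sum_k w k * ((F k i)^* * F k j) = (i == j)%:R) /\
  (forall k i, \sum_l A k l * F l i = s`_i * F k i).

Lemma eigenbasis_dual (F : 'M[C]_n) :
    (forall i j, \sum_k w k * ((F k i)^* * F k j) = (i == j)%:R) ->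
  (\matrix_(i, k) (w k * (F k i)^*)) *m F = 1%:M.
Proof.
move=> FE; apply/matrixP=> i j; rewrite !mxE -FE.
by apply: eq_bigr => k _; rewrite !mxE mulrA.
Qed.

(** Conjugation by the diagonal matrix of the [sqrtC (w i)] turns [A] into a real symmetric, hence
    normal, matrix [S]; a unitary eigenbasis of [S] is carried back by dividing by [h]. *)
Lemma reversible_eigenbasis (A : 'M[C]_n) (s : seq C) :
    (forall i j, A i j \is Num.real) -> reversible A ->
    char_poly A = \prod_(r <- s) ('X - r%:P) ->
  exists F : 'M[C]_n, eigenbasis A s F.
Proof.
move=> Areal Arev cpA.
pose h i := sqrtC (w i).
have h_gt0 i : 0 < h i by rewrite sqrtC_gt0.
have h_neq0 i : h i != 0 by rewrite gt_eqF.
have hh i : h i * h i = w i by rewrite -expr2 sqrtCK.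
have hC i : (h i)^* = h i by apply/CrealP/gtr0_real.
pose S : 'M[C]_n := \matrix_(i, j) (h i * A i j / h j).
have SE : S ^t* = S.
  apply/matrixP=> i j; rewrite !mxE !rmorphM /= fmorphV /= !hC (CrealP (Areal _ _)).
  apply/(mulIf (h_neq0 j))/(mulIf (h_neq0 i)).
  by rewrite mulrAC !divfK // mulrAC hh [RHS]mulrAC hh Arev.
have /orthomx_spectralP Sdec : S \is normalmx by apply/normalmxP; rewrite SE.
set U := spectralmx S in Sdec; set d := spectral_diag S in Sdec.
have uU : U \is unitarymx := spectral_unitarymx S.
have {}SE k i : \sum_l S k l * (U i l)^* = d 0 i * (U i k)^*.
  have : S *m U ^t* = U ^t* *m diag_mx d.
    by rewrite {1}Sdec invmx_unitary // -!mulmxA (unitarymxP uU) mulmx1.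
  move/matrixP/(_ k i); rewrite mul_mx_diag !mxE mulrC => <-.
  by apply: eq_bigr => l _; rewrite !mxE.
have UE i j : \sum_k U i k * (U j k)^* = (i == j)%:R.
  have /matrixP/(_ i j) := unitarymxP uU; rewrite !mxE => <-.
  by apply: eq_bigr => l _; rewrite !mxE.
pose F : 'M[C]_n := \matrix_(k, i) ((U i k)^* / h k).
have FE i j : \sum_k w k * ((F k i)^* * F k j) = (i == j)%:R.
  rewrite -UE; apply: eq_bigr => k _; rewrite !mxE rmorphM /= fmorphV /= hC conjCK.
  by rewrite mulrACA -invfM hh [_ / _]mulrC mulVKf // gt_eqF.
have AF k i : \sum_l A k l * F l i = d 0 i * F k i.
  apply: (mulfI (h_neq0 k)); rewrite mulr_sumr !mxE [RHS]mulrCA.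
  rewrite [h k * _]mulrC divfK // -SE; apply: eq_bigr => l _; rewrite !mxE.
  by rewrite [(U i l)^* / _]mulrC !mulrA.
clearbody F.
have uF : F \in unitmx.
  by case: (mulmx1_unit (eigenbasis_dual FE)).
(* Both lists consist of the roots of the characteristic polynomial, so they differ by a
   permutation, which then reorders the columns of [F]. *)
have : perm_eq s [tuple d 0 i | i < n].
  apply: prod_XsubC_eq; rewrite -cpA big_map /= big_enum /=.
  rewrite (@char_poly_intertwine _ _ A (diag_mx d) F uF).
    by rewrite char_poly_trig ?diag_mx_is_trig //; apply: eq_bigr => i _; rewrite !mxE eqxx.
  by apply/matrixP=> k i; rewrite mul_mx_diag !mxE mulrC -AF.
case/tuple_permP=> p sp.
have nths (i : 'I_n) : s`_i = d 0 (p i).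
  have /= -> := congr1 (fun t => nth 0 t i) sp.
  by rewrite (nth_map i) ?size_enum_ord // nth_ord_enum tnth_mktuple.
exists (\matrix_(k, i) F k (p i)); split=> [i j|k i].
  by rewrite -(inj_eq (@perm_inj _ p)) -FE; apply: eq_bigr => k _; rewrite !mxE.
by rewrite nths mxE -AF; apply: eq_bigr => l _; rewrite !mxE.
Qed.

(** * Weighted inner products and Dirichlet forms *)

Definition wdot (f g : 'I_n -> C) := \sum_k w k * ((f k)^* * g k).
Definition expand (F : 'M[C]_n) (v : 'I_n -> C) k := \sum_i F k i * v i.
Definition energy (A : 'M[C]_n) f := wdot f (fun k => f k - \sum_l A k l * f l).

Lemma wdot_expand (F : 'M[C]_n) (u v : 'I_n -> C) :
    (forall i j, \sum_k w k * ((F k i)^* * F k j) = (i == j)%:R) ->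
  wdot (expand F u) (expand F v) = \sum_i (u i)^* * v i.
Proof.
move=> FE; transitivity (\sum_i \sum_j (u i)^* * v j * (i == j)%:R).
  transitivity (\sum_k \sum_i \sum_j
      (u i)^* * v j * (w k * ((F k i)^* * F k j))).
    apply: eq_bigr => k _; rewrite rmorph_sum mulr_suml mulr_sumr.
    apply: eq_bigr => i _; rewrite !mulr_sumr; apply: eq_bigr => j _.
    rewrite rmorphM /= [RHS]mulrCA; congr (_ * _).
    by rewrite mulrACA mulrC.
  rewrite exchange_big; apply: eq_bigr => i _; rewrite exchange_big.
  by apply: eq_bigr => j _; rewrite -mulr_sumr FE.
apply: eq_bigr => i _; rewrite (bigD1 i) //= eqxx mulr1 big1 ?addr0 // => j.
by rewrite eq_sym => /negPf ->; rewrite mulr0.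
Qed.

Lemma energy_expand (A F : 'M[C]_n) s v : eigenbasis A s F ->
  energy A (expand F v) = \sum_(i < n) (1 - s`_i) * `|v i| ^+ 2.
Proof.
case=> FE AF; rewrite /energy.
transitivity (wdot (expand F v) (expand F (fun i => (1 - s`_i) * v i))).
  apply: eq_bigr => k _; congr (_ * (_ * _)).
  transitivity (\sum_(i < n) (F k i * v i - s`_i * F k i * v i)).
    rewrite sumrB; congr (_ - _).
    under eq_bigr do rewrite mulr_sumr; rewrite exchange_big.
    apply: eq_bigr => i _; rewrite -AF mulr_suml.
    by apply: eq_bigr => l _; rewrite mulrA.
  apply: eq_bigr => i _; rewrite mulrA mulrBr mulr1 mulrBl.
  by rewrite [F k i * s`_i]mulrC.
rewrite wdot_expand //; apply: eq_bigr => i _.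
by rewrite normCKC mulrCA.
Qed.

(** Add to the energy its copy with [i] and [j] exchanged: reversibility lets the two terms of each
    pair merge into a squared modulus. *)
Lemma dirichlet_form (A : 'M[C]_n) f :
    reversible A -> (forall i, \sum_j A i j = 1) ->
  energy A f *+ 2 = \sum_i \sum_j w i * A i j * `|f i - f j| ^+ 2.
Proof.
move=> Arev A1.
have E : energy A f = \sum_i \sum_j w i * A i j * ((f i)^* * (f i - f j)).
  apply: eq_bigr => i _; rewrite -[X in X - _]mul1r -(A1 i) mulr_suml -sumrB.
  rewrite !mulr_sumr; apply: eq_bigr => j _.
  by rewrite -mulrBr -mulrA; congr (_ * _); rewrite mulrCA.
rewrite mulr2n E [X in X + _]exchange_big -big_split; apply: eq_bigr => i _ /=.
rewrite -big_split; apply: eq_bigr => j _ /=.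
rewrite -[w j * _]Arev -mulrDr normCKC rmorphB /= mulrBl addrC; congr (_ * (_ + _)).
by rewrite -mulrN opprB.
Qed.

(** The diagonal terms of the Dirichlet form vanish, so bounds on the off-diagonal rates suffice. *)
Lemma energy_le (A B : 'M[C]_n) c f : reversible A -> reversible B ->
    (forall i, \sum_j A i j = 1) -> (forall i, \sum_j B i j = 1) ->
    (forall i j, i != j -> c * B i j <= A i j) ->
  c * energy B f <= energy A f.
Proof.
move=> Arev Brev A1 B1 cBA.
rewrite -(@ler_pMn2r _ 2) // -mulrnAr !dirichlet_form // mulr_sumr.
apply: ler_sum => i _; rewrite mulr_sumr; apply: ler_sum => j _.
have [->|ij] := eqVneq i j; first by rewrite subrr normr0 expr0n /= !mulr0.
rewrite mulrA ler_wpM2r ?exprn_ge0 // mulrCA ler_wpM2l ?cBA //.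
exact: ltW.
Qed.
End Reversible.

(** * Comparison of spectral gaps and relaxation times *)

(* The plane spanned by the two top eigenvectors of [A] contains a vector
   orthogonal to the top eigenvector of [B]; comparing the two energies of this
   vector avoids any appeal to the variational formula for the gap. *)
Lemma spectral_gap_le (C : numClosedFieldType) (n : nat) (w : 'I_n.+2 -> C)
    (A B : 'M[C]_n.+2) (s t : seq C) (c : C) :
    (forall i, 0 < w i) -> 0 <= c -> reversible w A -> reversible w B ->
    (forall i j, A i j \is Num.real) -> (forall i j, B i j \is Num.real) ->
    (forall i, \sum_j A i j = 1) -> (forall i, \sum_j B i j = 1) ->
    (forall i j, i != j -> c * B i j <= A i j) ->
    char_poly A = \prod_(r <- s) ('X - r%:P) -> sorted >=%R s ->
    char_poly B = \prod_(r <- t) ('X - r%:P) -> sorted >=%R t ->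
  c * (1 - t`_1) <= 1 - s`_1.
Proof.
move=> w_gt0 c_ge0 Arev Brev Areal Breal A1 B1 cBA cpA s_sort cpB t_sort.
have [F FP] := reversible_eigenbasis w_gt0 Areal Arev cpA.
have [G GP] := reversible_eigenbasis w_gt0 Breal Brev cpB.
have [FE _] := FP; have [GE _] := GP.
have sz_t : size t = n.+2.
  by apply/succn_inj; rewrite -(size_prod_XsubC _ id) -cpB size_char_poly.
have sz_s : size s = n.+2.
  by apply/succn_inj; rewrite -(size_prod_XsubC _ id) -cpA size_char_poly.
pose i0 : 'I_n.+2 := ord0; pose i1 : 'I_n.+2 := lift ord0 ord0.
(* [a i] is the component of column [i] of [F] along the top eigenvector of [B]; [p] and [q] combine
   columns 0 and 1 so that this component cancels. *)
pose a i := \sum_k w k * ((G k i0)^* * F k i).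
have [p [q [pq0 pqa]]] : exists p q, (p != 0) || (q != 0) /\ a i0 * p + a i1 * q = 0.
  have [a0|a0] := eqVneq (a i0) 0.
    by exists 1, 0; rewrite oner_eq0 a0 mul0r mulr0 addr0.
  by exists (- a i1), (a i0); rewrite a0 orbT mulrN mulrC addNr.
pose v i := if i == i0 then p else if i == i1 then q else 0.
have sumv (g : 'I_n.+2 -> C) (h : C -> C) : h 0 = 0 ->
    \sum_i g i * h (v i) = g i0 * h p + g i1 * h q.
  move=> h0; rewrite (bigD1 i0) //= (bigD1 i1) //= big1 => [|i /andP[]].
    by rewrite addr0.
  by rewrite /v => /negPf-> /negPf->; rewrite h0 mulr0.
pose f := expand F v.
(* The coordinates of [f] in the eigenbasis of [B]; they recover [f] because the left inverse of [G]
   is also a right inverse. *)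
pose u i := \sum_k w k * ((G k i)^* * f k).
have fu k : f k = expand G u k.
  have E l : \sum_i G k i * (w l * (G l i)^*) = (k == l)%:R.
    have /matrixP/(_ k l) := mulmx1C (eigenbasis_dual GE).
    by rewrite !mxE => <-; apply: eq_bigr => i _; rewrite !mxE.
  transitivity (\sum_l (k == l)%:R * f l).
    rewrite (bigD1 k) //= eqxx mul1r big1 ?addr0 // => l.
    by rewrite eq_sym => /negPf->; rewrite mul0r.
  under eq_bigr do rewrite -E mulr_suml.
  rewrite exchange_big; apply: eq_bigr => i _; rewrite mulr_sumr.
  by apply: eq_bigr => l _; rewrite !mulrA.
have u0 : u i0 = 0.
  rewrite -pqa -(sumv a id) // /u.
  under eq_bigr do rewrite !mulr_sumr; rewrite exchange_big.
  apply: eq_bigr => i _; rewrite mulr_suml; apply: eq_bigr => k _.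
  by rewrite !mulrA.
have wdotE g g' : g =1 g' -> wdot w g g = wdot w g' g'.
  by move=> gg'; apply: eq_bigr => k _; rewrite gg'.
have nf : \sum_i `|v i| ^+ 2 = \sum_i `|u i| ^+ 2.
  under eq_bigr do rewrite normCKC; under [RHS]eq_bigr do rewrite normCKC.
  by rewrite -(wdot_expand v v FE) -(wdot_expand u u GE) (wdotE _ _ fu).
have sumv2 (g : 'I_n.+2 -> C) :
    \sum_i g i * `|v i| ^+ 2 = g i0 * `|p| ^+ 2 + g i1 * `|q| ^+ 2.
  by rewrite (sumv g (fun x => `|x| ^+ 2)) // normr0 expr0n.
have nfE : \sum_i `|v i| ^+ 2 = `|p| ^+ 2 + `|q| ^+ 2.
  by rewrite -[RHS]mul1r mulrDr -(sumv2 (fun=> 1)); apply: eq_bigr => i _; rewrite mul1r.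
have nf_gt0 : 0 < \sum_i `|v i| ^+ 2.
  rewrite nfE; case/orP: pq0 => [p0|q0].
    by rewrite ltr_pwDl ?exprn_ge0 // exprn_gt0 // normr_gt0.
  by rewrite ltr_wpDl ?exprn_ge0 // exprn_gt0 // normr_gt0.
have t1 (i : 'I_n.+2) : i != i0 -> t`_i <= t`_1.
  move=> i_neq0; apply: (sorted_leq_nth _ _ 0 t_sort); rewrite ?inE ?sz_t //.
  - exact: rev_trans le_trans.
  - exact: lexx.
  by rewrite lt0n.
have s1 : s`_1 <= s`_0.
  by apply: (sorted_leq_nth _ _ 0 s_sort); rewrite ?inE ?sz_s //; [exact: rev_trans le_trans | exact: lexx].
(* [f] lies in the span of the two top eigenvectors of [A], where one minus the eigenvalue is at
   most the gap. *)
have EA : energy w A f <= (1 - s`_1) * \sum_i `|v i| ^+ 2.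
  rewrite (energy_expand v FP) sumv2 nfE mulrDr lerD2r ler_wpM2r ?exprn_ge0 //.
  by rewrite lerD2l lerN2.
(* [f] has no component on the top eigenvector of [B], and the other eigenvalues are at most the
   second. *)
have EB : (1 - t`_1) * \sum_i `|v i| ^+ 2 <= energy w B f.
  have -> : energy w B f = energy w B (expand G u).
    by apply: eq_bigr => k _; under eq_bigr do rewrite fu; rewrite fu.
  rewrite (energy_expand u GP) nf mulr_sumr; apply: ler_sum => i _.
  have [->|/t1 ti] := eqVneq i i0; first by rewrite u0 normr0 expr0n /= !mulr0.
  by rewrite ler_wpM2r ?exprn_ge0 // lerD2l lerN2.
rewrite -(ler_pM2r nf_gt0) -mulrA.
apply: le_trans EA; apply: le_trans (energy_le _ _ _ _ _ _ cBA) => //.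
exact: ler_wpM2l.
Qed.

(** The diagonalization takes place over a closed field, so the real matrices are embedded in
    [R[i]]; the embedding preserves the order and the factored characteristic polynomials. *)
Lemma second_eigenvalue_gap_le (R : realType) (k : nat) (w : 'I_k -> R)
    (A B : 'M[R]_k) (a b c : R) :
    (1 < k)%N -> (forall i, 0 < w i) -> 0 <= c ->
    (forall i j, w i * A i j = w j * A j i) ->
    (forall i j, w i * B i j = w j * B j i) ->
    (forall i, \sum_j A i j = 1) -> (forall i, \sum_j B i j = 1) ->
    (forall i j, i != j -> c * B i j <= A i j) ->
    second_eigenvalue A a -> second_eigenvalue B b ->
  c * (1 - b) <= 1 - a.
Proof.
case: k w A B => [|[|k]] // w A B _ w_gt0 c_ge0 Arev Brev A1 B1 cBA.
move=> [s [cpA s_sort <-]] [t [cpB t_sort <-]].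
pose toC : {rmorphism R -> R[i]} := real_complex R.
have leC : {mono toC : x y / x <= y} := @lecR R.
have cpC (M : 'M[R]_k.+2) u : char_poly M = \prod_(r <- u) ('X - r%:P) ->
    char_poly (map_mx toC M) = \prod_(r <- map toC u) ('X - r%:P).
  by move=> cpM; rewrite -map_char_poly cpM map_prod_XsubC big_map.
have sortC u : sorted >=%R u -> sorted >=%R (map toC u).
  by rewrite sorted_map; apply: sub_sorted => x y; rewrite /= leC.
have nthC u : (map toC u)`_1 = toC u`_1.
  by have [?|?] := ltnP 1 (size u); [exact: nth_map | rewrite !nth_default ?size_map].
have sumC (M : 'M[R]_k.+2) : (forall i, \sum_j M i j = 1) ->
    forall i, \sum_j map_mx toC M i j = 1.
  move=> M1 i; rewrite -(rmorph1 toC) -(M1 i) rmorph_sum.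
  by apply: eq_bigr => j _; rewrite mxE.
have revC (M : 'M[R]_k.+2) : (forall i j, w i * M i j = w j * M j i) ->
    reversible (toC \o w) (map_mx toC M).
  by move=> Mrev i j; rewrite !mxE /= -!rmorphM Mrev.
have realC (M : 'M[R]_k.+2) i j : map_mx toC M i j \is Num.real.
  by rewrite mxE; apply/complex_realP; exists (M i j).
rewrite -leC rmorphM !rmorphB rmorph1 -!nthC.
apply: (@spectral_gap_le _ _ (toC \o w) (map_mx toC A) (map_mx toC B)); auto.
- by move=> i; rewrite /= ltcR.
- by rewrite ler0c.
- by move=> i j ij; rewrite !mxE -rmorphM leC cBA.
Qed.

(** Larger rates give a larger gap and a shorter relaxation time, which is why the constants move to
    [tA]. *)
Lemma relaxation_time_compare (R : realType) (k : nat) (w : 'I_k -> R)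
    (A B : 'M[R]_k) (tA tB c d : R) :
    (1 < k)%N -> (forall i, 0 < w i) -> 0 < c -> 0 < d ->
    (forall i j, w i * A i j = w j * A j i) ->
    (forall i j, w i * B i j = w j * B j i) ->
    (forall i, \sum_j A i j = 1) -> (forall i, \sum_j B i j = 1) ->
    (forall i j, i != j -> 0 <= B i j) ->
    (forall i j, i != j -> c * B i j <= A i j <= d * B i j) ->
    relaxation_time A tA -> relaxation_time B tB ->
  c * tA <= tB /\ tB <= d * tA.
Proof.
move=> k1 w_gt0 c_gt0 d_gt0 Arev Brev A1 B1 B_ge0 AB [a [Aa ->]] [b [Bb ->]].
have cba : c * (1 - b) <= 1 - a.
  apply: (second_eigenvalue_gap_le k1 w_gt0 (ltW c_gt0) Arev Brev) => // i j ij.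
  by case/andP: (AB i j ij).
have dab : d^-1 * (1 - a) <= 1 - b.
  have := ltW d_gt0; rewrite -invr_ge0 => id_ge0.
  apply: (second_eigenvalue_gap_le k1 w_gt0 id_ge0 Brev Arev) => // i j ij.
  by rewrite ler_pdivrMl //; case/andP: (AB i j ij).
(* Comparing [B] with itself, with constant 0, shows that its gap is nonnegative. *)
have b_ge0 : 0 <= 1 - b.
  rewrite -(mul0r (1 - b)).
  apply: (second_eigenvalue_gap_le k1 w_gt0 (lexx 0) Brev Brev) => // i j ij.
  by rewrite mul0r B_ge0.
have a_ge0 : 0 <= 1 - a by apply: le_trans cba; rewrite mulr_ge0 // ltW.
(* The two gaps vanish together, and both relaxation times are then 0 by the convention
   [0^-1 = 0]. *)
have [b0|b0] := eqVneq (1 - b) 0.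
  have -> : 1 - a = 0.
    apply/eqP; rewrite eq_le a_ge0 andbT.
    by move: dab; rewrite b0 ler_pdivrMl // mulr0.
  by rewrite b0 invr0 !mulr0 lexx.
have b_gt0 : 0 < 1 - b by rewrite lt0r b0.
have a_gt0 : 0 < 1 - a by apply: lt_le_trans cba; rewrite mulr_gt0.
split; first by rewrite ler_pdivrMr // ler_pdivlMl // mulrC.
by rewrite ler_pdivlMr // ler_pdivrMl // [_ * d]mulrC -ler_pdivrMl.
Qed.

(** * Chains on tables given by their off-diagonal rates *)

Section Tables.
Variables (I J n : nat) (lam : 'I_I -> nat) (mu : 'I_J -> nat).
Local Notation T := (table n lam mu).
Implicit Types (x y : T) (c : cell I J).

Lemma kernel_relaxation_time_compare (R : realType) (w : T -> R)
    (offA offB : T -> T -> R) (tA tB c d : R) :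
    (1 < #|{: T}|)%N -> (forall x, 0 < w x) -> 0 < c -> 0 < d ->
    (forall x y, w x * offA x y = w y * offA y x) ->
    (forall x y, w x * offB x y = w y * offB y x) ->
    (forall x y, 0 <= offB x y) ->
    (forall x y, c * offB x y <= offA x y <= d * offB x y) ->
    relaxation_time (chain_mx (kernel offA)) tA ->
    relaxation_time (chain_mx (kernel offB)) tB ->
  c * tA <= tB /\ tB <= d * tA.
Proof.
move=> T1 w_gt0 c_gt0 d_gt0 revA revB B_ge0 AB.
have kernelE off (i j : 'I_#|{: T}|) : i != j ->
    chain_mx (kernel off) i j = off (enum_val i) (enum_val j) :> R.
  by move=> ij; rewrite mxE /kernel (inj_eq enum_val_inj) (negPf ij).
have rev_mx (off : T -> T -> R) : (forall x y, w x * off x y = w y * off y x) -> forall i j,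
    w (enum_val i) * chain_mx (kernel off) i j =
    w (enum_val j) * chain_mx (kernel off) j i.
  by move=> rev i j; have [->//|ij] := eqVneq i j; rewrite !kernelE // eq_sym.
have sum1 (off : T -> T -> R) i : \sum_j chain_mx (kernel off) i j = 1 :> R.
  transitivity (\sum_(y : T) kernel off (enum_val i) y).
    by rewrite [RHS](big_enum_val _) /=; apply: eq_bigr => j _; rewrite mxE.
  rewrite (bigD1 (enum_val i)) //= {1}/kernel eqxx.
  rewrite [X in _ + X](eq_bigr (off (enum_val i))) ?subrK // => y.
  by rewrite /kernel eq_sym => /negPf->.
apply: (@relaxation_time_compare _ _ (w \o enum_val)) => //=.
- exact: rev_mx.
- exact: rev_mx.
- by move=> i j ij; rewrite kernelE.
- by move=> i j ij; rewrite !kernelE.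
Qed.

(** * Moves and their inverses *)

Definition swap (c1 c2 : cell I J) : cell I J := (c1.1, c2.2).

(** The cells [swap c1 c2] and [swap c2 c1] are the other two corners of the rectangle; subtracting
    there undoes the move. *)
Lemma is_move_sym x y c1 c2 :
  is_move x y c1 c2 = is_move y x (swap c1 c2) (swap c2 c1).
Proof.
case: c1 c2 => [i1 j1] [i2 j2]; rewrite /is_move /swap /= [j2 == j1]eq_sym.
congr [&& _, _ & _].
by apply: eq_forallb => c; rewrite eq_sym.
Qed.

(** Passing to the inverse move is an involution on pairs of cells, so rates in the two directions
    can be compared term by term. *)
Lemma big_move_sym (R : realType) x y (f : cell I J -> cell I J -> R) :
  \sum_c1 \sum_(c2 | is_move x y c1 c2) f c1 c2 =
  \sum_c1 \sum_(c2 | is_move y x c1 c2) f (swap c1 c2) (swap c2 c1).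
Proof.
rewrite !pair_big_dep /=.
pose h (p : cell I J * cell I J) := (swap p.1 p.2, swap p.2 p.1).
have hK : involutive h by case=> [[i1 j1] [i2 j2]].
rewrite (reindex_inj (inv_inj hK)) /=; apply: eq_bigl => p.
by rewrite is_move_sym; case: p => [[i1 j1] [i2 j2]].
Qed.

(* The additions of [is_move] are parsed in [ring_scope]; here they are [addn]. *)
Lemma is_moveP x y c1 c2 : reflect
  [/\ c1.1 != c2.1, c1.2 != c2.2 &
     forall c, (entry y c + (c == c1) + (c == c2) =
                entry x c + (c == swap c1 c2) + (c == swap c2 c1))%N]
  (is_move x y c1 c2).
Proof.
apply: (iffP and3P) => -[i12 j12]; first by move/forallP=> mv; split=> // c; apply/eqP/mv.
by move=> mv; split=> //; apply/forallP=> c; apply/eqP/mv.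
Qed.

(** At [c1] the move equation reads [entry y c1 + 1 = entry x c1], and likewise at [c2]; the inverse
    move gives the claim for [y]. *)
Lemma move_entry x y c1 c2 : is_move x y c1 c2 ->
  [/\ (0 < entry x c1)%N, (0 < entry x c2)%N,
      (0 < entry y (swap c1 c2))%N & (0 < entry y (swap c2 c1))%N].
Proof.
have pos x' y' d1 d2 : is_move x' y' d1 d2 -> (0 < entry x' d1)%N && (0 < entry x' d2)%N.
  case: d1 d2 => [i1 j1] [i2 j2] /is_moveP[/= /negPf ni /negPf nj mv].
  have := mv (i1, j1); have := mv (i2, j2).
  rewrite !xpair_eqE /= !eqxx ![i2 == _]eq_sym ![j2 == _]eq_sym ni nj /= !addn0.
  by move=> <- <-; rewrite !addn1.
move=> mv; have /andP[-> ->] := pos _ _ _ _ mv.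
by rewrite is_move_sym in mv; have /andP[-> ->] := pos _ _ _ _ mv.
Qed.

(** This is the ratio of Fisher-Yates weights with denominators cleared: only the four corners
    change, each by one factor from [(k+1)! = (k+1) k!]. *)
Lemma move_prod_fact x y c1 c2 : is_move x y c1 c2 ->
  (\prod_c (entry x c)`! * (entry y (swap c1 c2) * entry y (swap c2 c1)) =
   \prod_c (entry y c)`! * (entry x c1 * entry x c2))%N.
Proof.
(* A single factor becomes a product over all cells, so that the identity can be checked cell by
   cell. *)
have pick (f : cell I J -> nat) c0 : (f c0 = \prod_c (if c == c0 then f c else 1))%N.
  by rewrite -big_mkcond big_pred1_eq.
case: c1 c2 => [i1 j1] [i2 j2] /is_moveP[/= /negPf ni /negPf nj mv].
rewrite /swap /= (pick (entry y) (i1, j2)) (pick (entry y) (i2, j1)).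
rewrite (pick (entry x) (i1, j1)) (pick (entry x) (i2, j2)).
rewrite -!big_split; apply: eq_bigr => -[i j] _ /=.
have := mv (i, j); rewrite !xpair_eqE /=.
have [->|_] := eqVneq i i1.
  rewrite ni /=; have [->|_] := eqVneq j j1.
    by rewrite nj /= !addn0 !muln1 addn1 => <-; rewrite factS mulnC.
  case: eqP => _ /=; rewrite !addn0 !muln1 ?mul1n; last by move=> ->.
  by move=> ->; rewrite addn1 factS mulnC.
have [->|_] := eqVneq i i2; rewrite /= ?addn0 ?muln1; last by move=> ->.
have [->|_] := eqVneq j j1.
  by rewrite nj /= !addn0 ?mul1n !muln1 => ->; rewrite addn1 factS mulnC.
case: eqP => _ /=; rewrite !addn0 ?mul1n ?muln1; last by move=> ->.
by rewrite addn1 => <-; rewrite factS mulnC.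
Qed.

(** * Extremal entries and existence of moves *)

Lemma bigminn_le (K : finType) (P : pred K) (F : K -> nat) k i :
  P i -> (\big[minn/k]_(j | P j) F j <= F i)%N.
Proof.
move=> Pi; have : i \in index_enum K by rewrite mem_index_enum.
elim: (index_enum K) => // j r IH; rewrite big_cons inE => /orP[/eqP <-|/IH].
  by rewrite Pi geq_minl.
by case: ifP => // _; apply: leq_trans; rewrite geq_minr.
Qed.

Lemma m_lm_le x c : (0 < entry x c)%N -> (m_lm n lam mu <= entry x c)%N.
Proof.
move=> xc; apply: leq_trans (bigminn_le _ _ xc); exact: bigminn_le.
Qed.

Lemma le_M_lm x c : (entry x c <= M_lm n lam mu)%N.
Proof.
apply: leq_trans (@leq_bigmax _ (entry x) c) _.
exact: (@leq_bigmax _ (fun x : T => \max_c entry x c)).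
Qed.

(** The iterated minima start from the default [n], which has to be positive as well. *)
Lemma m_lm_gt0 : (0 < n)%N -> (0 < m_lm n lam mu)%N.
Proof.
move=> n0; have minP a b : (0 < a)%N -> (0 < b)%N -> (0 < minn a b)%N by rewrite leq_min => -> ->.
by apply: (big_ind (leq 1)) => // x _; apply: (big_ind (leq 1)).
Qed.

Lemma table_rows x i : (\sum_(j < J) entry x (i, j))%N = lam i.
Proof. by have /andP[/forallP/(_ i)/eqP] := valP x. Qed.

Lemma table_cols x j : (\sum_(i < I) entry x (i, j))%N = mu j.
Proof. by have /andP[_ /forallP/(_ j)/eqP] := valP x. Qed.

Lemma entry_le_lam x i j : (entry x (i, j) <= lam i)%N.
Proof. by rewrite -(table_rows x i) (bigD1 j) //= leq_addr. Qed.

Lemma M_lm_le :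
  (M_lm n lam mu <= \max_(i < I) \max_(j < J) maxn (lam i) (mu j))%N.
Proof.
apply/bigmax_leqP => x _; apply/bigmax_leqP => -[i j] _.
apply: leq_trans (entry_le_lam x i j) _.
apply: leq_trans (leq_bigmax i).
exact: leq_trans (leq_maxl _ _) (leq_bigmax j).
Qed.

(** From a cell where [x] exceeds [y], equal column sums lead to a cell of that column where [y]
    exceeds [x], and equal row sums then to a cell of its row where [x] exceeds [y]. The first and
    last cells are opposite corners. *)
Lemma exists_move_pair x y : x != y -> exists c1 c2,
  [/\ c1.1 != c2.1, c1.2 != c2.2, (0 < entry x c1)%N & (0 < entry x c2)%N].
Proof.
have gt_ex (K : finType) (F G : K -> nat) k : (\sum_i F i = \sum_i G i)%N ->
    (F k < G k)%N -> exists2 l, l != k & (G l < F l)%N.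
  move=> FG Fk; have [/existsP[l /andP[]]|] := boolP [exists l, (l != k) && (G l < F l)%N].
    by exists l.
  rewrite negb_exists => /forallP le_FG; suff : (\sum_i F i < \sum_i G i)%N by rewrite FG ltnn.
  rewrite (bigD1 k) //= [X in (_ < X)%N](bigD1 k) //= -addSn leq_add //.
  by apply: leq_sum => l lk; have := le_FG l; rewrite lk /= -leqNgt.
move=> xy; have [[i1 j1] ne] : exists c, entry x c != entry y c.
  apply/existsP; rewrite -negb_forall; apply: contra xy => /forallP exy.
  by apply/eqP/val_inj/ffunP => c; apply/val_inj/eqP/exy.
have [i [j lt_yx]] : exists i j, (entry y (i, j) < entry x (i, j))%N.
  case: (ltngtP (entry x (i1, j1)) (entry y (i1, j1))) ne => // [lt_xy|lt_yx] _; last by exists i1, j1.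
  have [j _ ?] := gt_ex _ (fun j => entry x (i1, j)) (fun j => entry y (i1, j)) j1
    (etrans (table_rows x i1) (esym (table_rows y i1))) lt_xy.
  by exists i1, j.
have [i2 i2i lt2] := gt_ex _ (fun i => entry y (i, j)) (fun i => entry x (i, j)) i
  (etrans (table_cols y j) (esym (table_cols x j))) lt_yx.
have [j2 j2j lt3] := gt_ex _ (fun j => entry x (i2, j)) (fun j => entry y (i2, j)) j
  (etrans (table_rows x i2) (esym (table_rows y i2))) lt2.
exists (i, j), (i2, j2); split=> /=; rewrite 1?eq_sym //.
  exact: leq_ltn_trans lt_yx.
exact: leq_ltn_trans lt3.
Qed.

(* [y] is obtained by applying the move through [c1] and [c2] exactly [k] times. *)
Lemma exists_iter_move x c1 c2 k : (forall i, lam i <= n)%N ->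
    c1.1 != c2.1 -> c1.2 != c2.2 ->
    (k <= entry x c1)%N -> (k <= entry x c2)%N ->
  exists y : T, entry y c1 = (entry x c1 - k)%N.
Proof.
case: c1 c2 => [i1 j1] [i2 j2] /= lam_le i12 j12 k1 k2.
(* The truncated subtraction is exact, since the entries at the two decreasing corners are at least
   [k]; [eE] restates it additively. *)
pose e (c : cell I J) := (entry x c + k * ((c == (i1, j2)) + (c == (i2, j1)))
                          - k * ((c == (i1, j1)) + (c == (i2, j2))))%N.
have eE c : (e c + k * ((c == (i1, j1)) + (c == (i2, j2))) =
             entry x c + k * ((c == (i1, j2)) + (c == (i2, j1))))%N.
  rewrite /e subnK //; have [->|n1] := eqVneq c (i1, j1).
    by rewrite xpair_eqE (negPf i12) muln1 (leq_trans k1) ?leq_addr.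
  have [->|n2] := eqVneq c (i2, j2); last by rewrite muln0.
  by rewrite muln1 (leq_trans k2) ?leq_addr.
have sumR (a i : 'I_I) (b : 'I_J) : (\sum_(j < J) ((i, j) == (a, b)) = (i == a))%N.
  rewrite (bigD1 b) //= xpair_eqE eqxx andbT big1 ?addn0 // => j jb.
  by rewrite xpair_eqE (negPf jb) andbF.
have sumC (a : 'I_I) (b j : 'I_J) : (\sum_(i < I) ((i, j) == (a, b)) = (j == b))%N.
  rewrite (bigD1 a) //= xpair_eqE eqxx big1 ?addn0 // => i ia.
  by rewrite xpair_eqE (negPf ia).
have rowsE i : (\sum_(j < J) e (i, j) = lam i)%N.
  apply: (@addIn (k * ((i == i1) + (i == i2)))%N).
  rewrite -{1}(sumR i1 i j1) -{1}(sumR i2 i j2) -big_split big_distrr -big_split /=.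
  under eq_bigr do rewrite eE.
  by rewrite big_split -big_distrr big_split /= table_rows !sumR.
have colsE j : (\sum_(i < I) e (i, j) = mu j)%N.
  apply: (@addIn (k * ((j == j1) + (j == j2)))%N).
  rewrite -{1}(sumC i1 j1) -{1}(sumC i2 j2) -big_split big_distrr -big_split /=.
  under eq_bigr do rewrite eE.
  by rewrite big_split -big_distrr big_split /= table_cols !sumC; congr (_ + k * _)%N; rewrite addnC.
have e_le c : (e c < n.+1)%N.
  case: c => i j; rewrite ltnS (leq_trans _ (lam_le i)) // -(rowsE i).
  by rewrite (bigD1 j) //= leq_addr.
pose t : tab I J n := [ffun c => Ordinal (e_le c)].
have tP : is_table lam mu t.
  apply/andP; split; apply/forallP => i; apply/eqP.
    by rewrite -[RHS]rowsE; apply: eq_bigr => j _; rewrite ffunE.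
  by rewrite -[RHS]colsE; apply: eq_bigr => j _; rewrite ffunE.
exists (exist _ t tP); rewrite /entry /= ffunE /= /e !xpair_eqE !eqxx /=.
by rewrite (negPf i12) (negPf j12) muln0 addn0 muln1.
Qed.

(* A move can be iterated until one of the two decreasing entries is 1. Since
   [m = 1], the fourth power of [m] in the theorem is no stronger than the
   square that the comparison of transition rates provides. *)
Lemma m_lm_eq1 : (forall i, lam i <= n)%N -> (1 < #|{: T}|)%N -> m_lm n lam mu = 1%N.
Proof.
move=> lam_le /card_gt1P[x [y [_ _ xy]]].
have [c1 [c2 [i12 j12 x1 x2]]] := exists_move_pair xy.
wlog le12 : c1 c2 i12 j12 x1 x2 / (entry x c1 <= entry x c2)%N.
  move=> H; case/orP: (leq_total (entry x c1) (entry x c2)) => le; first exact: (H c1 c2).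
  by apply: (H c2 c1) => //; rewrite eq_sym.
(* Iterating one time less than the smaller entry leaves 1 at [c1]. *)
have [z zE] := exists_iter_move lam_le i12 j12 (leq_pred _) (leq_trans (leq_pred _) le12).
have z1 : entry z c1 = 1%N by rewrite zE; case: (entry x c1) x1 => //= k _; rewrite subSnn.
have n0 : (0 < n)%N.
  by case: c1 x1 {i12 j12 le12 z1 zE} => i j x1; rewrite (leq_trans x1) // (leq_trans (entry_le_lam _ _ _)).
by apply/eqP; rewrite eqn_leq m_lm_gt0 // -{1}z1 m_lm_le // z1.
Qed.

(** * Reversibility and comparison of the rates *)

Variable R : realType.

Lemma PU_off_sym x y : PU_off R x y = PU_off R y x.
Proof. by rewrite /PU_off big_move_sym. Qed.

Lemma PU_off_ge0 x y : 0 <= PU_off R x y.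
Proof.
by apply: sumr_ge0 => c1 _; apply: sumr_ge0 => c2 _; rewrite divr_ge0 ?exprn_ge0.
Qed.

Lemma piFY_gt0 x : 0 < piFY R x.
Proof.
rewrite divr_gt0 ?mulr_gt0 ?ltr0n ?fact_gt0 //;
  by apply: prodr_gt0 => i _; rewrite ltr0n fact_gt0.
Qed.

(** Detailed balance between one move and its inverse, up to the factor [n^2]. *)
Lemma piFY_move x y c1 c2 : is_move x y c1 c2 ->
  piFY R x * (entry x c1 * entry x c2)%:R =
  piFY R y * (entry y (swap c1 c2) * entry y (swap c2 c1))%:R.
Proof.
move=> mv; rewrite /piFY -!natr_prod.
have := move_prod_fact mv.
set Nx := (\prod_c (entry x c)`!)%N; set Ny := (\prod_c (entry y c)`!)%N => E.
have Nx0 : Nx%:R != 0 :> R by rewrite pnatr_eq0 -lt0n prodn_gt0 // => c; rewrite fact_gt0.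
have Ny0 : Ny%:R != 0 :> R by rewrite pnatr_eq0 -lt0n prodn_gt0 // => c; rewrite fact_gt0.
have n0 : n`!%:R != 0 :> R by rewrite pnatr_eq0 -lt0n fact_gt0.
rewrite !invfM -!mulrA; congr (_ * (_ * (_ * _))).
apply: (mulfI Nx0); apply: (mulfI Ny0).
by rewrite mulVKf // mulrCA mulVKf // -!natrM E.
Qed.

Lemma PFY_off_reversible x y : piFY R x * PFY_off R x y = piFY R y * PFY_off R y x.
Proof.
rewrite /PFY_off [in RHS]big_move_sym !mulr_sumr; apply: eq_bigr => c1 _.
rewrite !mulr_sumr; apply: eq_bigr => c2 mv.
by rewrite !mulrA (piFY_move mv).
Qed.

(** Multiplying the Metropolis rate by [piFY x] gives [PU_off] times the minimum of the two weights,
    which is symmetric. *)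
Lemma PFYM_off_reversible x y : piFY R x * PFYM_off R x y = piFY R y * PFYM_off R y x.
Proof.
have E (u v : T) : piFY R u * PFYM_off R u v = PU_off R u v * Num.min (piFY R u) (piFY R v).
  by rewrite mulrCA minr_pMr ?ltW ?piFY_gt0 // mulr1 [piFY R u * _]mulrC divfK // gt_eqF ?piFY_gt0.
by rewrite !E PU_off_sym minC.
Qed.

Lemma PFYM_off_ge0 x y : 0 <= PFYM_off R x y.
Proof.
by rewrite mulr_ge0 ?PU_off_ge0 // le_min ler01 divr_ge0 // ltW ?piFY_gt0.
Qed.

Hypotheses (lam_le : forall i, (lam i <= n)%N) (T1 : (1 < #|{: T}|)%N).

Lemma dims_gt0 : (0 < I * J)%N /\ (0 < n)%N.
Proof.
case/card_gt1P: T1 => x [y [_ _ /exists_move_pair[[i j] [_ [_ _ xc _]]]]].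
split; first by rewrite muln_gt0 (leq_ltn_trans _ (ltn_ord i)) ?(leq_ltn_trans _ (ltn_ord j)).
exact: leq_trans xc (leq_trans (entry_le_lam x i j) (lam_le i)).
Qed.

Local Notation m := (m_lm n lam mu).
Local Notation M := (M_lm n lam mu).

Lemma M_lm_gt0 : (0 < M)%N.
Proof.
case/card_gt1P: T1 => x [y [_ _ /exists_move_pair[c [_ [_ _ xc _]]]]].
exact: leq_trans xc (le_M_lm x c).
Qed.

(** The bounds hold move by move: the factor [(I * J)^2] cancels the weight in [PU_off], leaving a
    product of two positive entries between [m^2] and [M^2]. *)
Lemma PU_PFY_off_bounds x y :
  (m ^ 2 * (I * J) ^ 2)%:R / (n ^ 2)%:R * PU_off R x y <= PFY_off R x y
    <= (M ^ 2 * (I * J) ^ 2)%:R / (n ^ 2)%:R * PU_off R x y.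
Proof.
have [IJ0 _] := dims_gt0.
have E k : (k ^ 2 * (I * J) ^ 2)%:R / (n ^ 2)%:R * (1 / (I * J)%:R ^+ 2) =
    (k * k)%:R / n%:R ^+ 2 :> R.
  rewrite natrM !natrX mul1r mulrAC mulfK ?natrM //.
  by rewrite expf_neq0 // -natrM pnatr_eq0 -lt0n.
have pos : 0 <= (n%:R ^+ 2)^-1 :> R by rewrite invr_ge0 exprn_ge0.
rewrite /PU_off /PFY_off !mulr_sumr; apply/andP; split.
  apply: ler_sum => c1 _; rewrite mulr_sumr; apply: ler_sum => c2 mv.
  have [x1 x2 _ _] := move_entry mv.
  by rewrite E ler_wpM2r // ler_nat leq_mul ?m_lm_le.
apply: ler_sum => c1 _; rewrite mulr_sumr; apply: ler_sum => c2 mv.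
by rewrite E ler_wpM2r // ler_nat leq_mul ?le_M_lm.
Qed.

Lemma PU_PUM_off_bounds x y :
  (m ^ 2 * (I * J) ^ 2)%:R / (n ^ 2)%:R * PU_off R x y <= PUM_off R x y
    <= (M ^ 2 * (I * J) ^ 2)%:R / (n ^ 2)%:R * PU_off R x y.
Proof.
have /andP[l1 u1] := PU_PFY_off_bounds x y.
have /andP[l2 _] := PU_PFY_off_bounds y x.
by rewrite /PUM_off le_min ge_min u1 l1 PU_off_sym l2.
Qed.

Lemma PFYM_PFY_off_bounds x y :
  ((I * J) ^ 2 * m ^ 4)%:R / (n ^ 2)%:R * PFYM_off R x y <= PFY_off R x y
    <= ((I * J) ^ 2 * M ^ 4)%:R / (n ^ 2)%:R * PFYM_off R x y.
Proof.
have [IJ0 _] := dims_gt0.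
pose r := Num.min 1 (piFY R y / piFY R x).
have E k : ((I * J) ^ 2 * k)%:R / (n ^ 2)%:R * (1 / (I * J)%:R ^+ 2 * r) =
    k%:R * r / n%:R ^+ 2 :> R.
  rewrite natrM !natrX mul1r; set u : R := _ ^+ 2.
  have u0 : u != 0 by rewrite expf_neq0 // pnatr_eq0 -lt0n.
  clearbody u; rewrite [u * _]mulrC -!mulrA; congr (_ * _).
  by rewrite mulrCA mulVKf // mulrC.
have pos : 0 <= (n%:R ^+ 2)^-1 :> R by rewrite invr_ge0 exprn_ge0.
rewrite /PFYM_off -/r /PU_off /PFY_off !mulr_suml !mulr_sumr; apply/andP; split.
  apply: ler_sum => c1 _; rewrite mulr_suml mulr_sumr; apply: ler_sum => c2 mv.
  have [x1 x2 _ _] := move_entry mv.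
  (* With [m = 1] it remains that [r] is at most 1 and the product of the two positive entries at
     least 1. *)
  rewrite E ler_wpM2r // m_lm_eq1 // exp1n mul1r (@le_trans _ _ 1) //.
    by rewrite /r ge_min lexx.
  by rewrite ler1n muln_gt0 x1.
apply: ler_sum => c1 _; rewrite mulr_suml mulr_sumr; apply: ler_sum => c2 mv.
rewrite E ler_wpM2r //.
have [x1 x2 y1 y2] := move_entry mv.
(* Two entries only produce [M^2]; [M >= 1] raises this to the stated fourth power. *)
have M4 k l : (k <= M -> l <= M -> k * l <= M ^ 4)%N.
  move=> kM lM; apply: leq_trans (leq_mul kM lM) _.
  by rewrite mulnn leq_pexp2l ?M_lm_gt0.
set p := (entry x c1 * entry x c2)%N.
set q := (entry y (swap c1 c2) * entry y (swap c2 c1))%N.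
have q_gt0 : 0 < q%:R :> R by rewrite ltr0n muln_gt0 y1.
have -> : r = Num.min 1 (p%:R / q%:R).
  congr (Num.min 1 _); apply/eqP.
  have := piFY_move mv; rewrite -/p -/q => pq.
  by rewrite (eqr_div _ _ (lt0r_neq0 (piFY_gt0 x)) (lt0r_neq0 q_gt0)) -pq mulrC.
(* The claim [p <= M^4 * min(1, p / q)] follows from [p <= M^4] and [q <= M^4]. *)
rewrite minr_pMr ?ler0n // le_min mulr1 ler_nat M4 ?le_M_lm //=.
by rewrite mulrA ler_pdivlMr // -!natrM ler_nat mulnC leq_mul // M4 ?le_M_lm.
Qed.
End Tables.

(** * Comparison of the relaxation times of the four chains *)

Lemma is_partition_le (k n : nat) (p : 'I_k -> nat) i : is_partition n p -> (p i <= n)%N.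
Proof. by case=> <- _ _; rewrite [leqRHS](bigD1 i) //= leq_addr. Qed.

Theorem theorem5p2 (R : realType) (I J n : nat) (lam : 'I_I -> nat) (mu : 'I_J -> nat)
  (Hlam : is_partition n lam) (Hmu : is_partition n mu)
  (Hcard : (1 < #|{: table n lam mu}|)%N)
  (tFY tFYM tU tUM : R)
  (HFY : relaxation_time (@chain_mx I J n lam mu R (@P_FY I J n lam mu R)) tFY)
  (HFYM : relaxation_time (@chain_mx I J n lam mu R (@P_FYM I J n lam mu R)) tFYM)
  (HU : relaxation_time (@chain_mx I J n lam mu R (@P_U I J n lam mu R)) tU)
  (HUM : relaxation_time (@chain_mx I J n lam mu R (@P_UM I J n lam mu R)) tUM) :
  let m := m_lm n lam mu in
  let M := M_lm n lam mu in
  [/\ ((m ^ 2 * (I * J) ^ 2)%:R / (n ^ 2)%:R * tUM <= tU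
      /\ tU <= (M ^ 2 * (I * J) ^ 2)%:R / (n ^ 2)%:R * tUM),
      ((n ^ 2)%:R / ((I * J) ^ 2 * M ^ 4)%:R * tFYM <= tFY /\
      tFY <= (n ^ 2)%:R / ((I * J) ^ 2 * m ^ 4)%:R * tFYM),
      (1 <= m)%N
    & (M <= \max_(i < I) \max_(j < J) maxn (lam i) (mu j))%N].
Proof.
move=> m M.
have lam_le i : (lam i <= n)%N := is_partition_le i Hlam.
have [IJ_gt0 n_gt0] := dims_gt0 lam_le Hcard.
have m_gt0 : (0 < m)%N := m_lm_gt0 lam mu n_gt0.
have M_gt0 : (0 < M)%N := M_lm_gt0 Hcard.
have coef_gt0 k : (0 < k)%N -> 0 < k%:R / (n ^ 2)%:R :> R.
  by move=> k_gt0; rewrite divr_gt0 // ltr0n // expn_gt0 n_gt0.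
have IJ2_gt0 : (0 < (I * J) ^ 2)%N by rewrite expn_gt0 IJ_gt0.
have k_gt0 k e : (0 < k -> 0 < k ^ e)%N by rewrite expn_gt0 => ->.
split=> //; last exact: M_lm_le.
  (* Both chains of (a) have symmetric rates, hence the constant weight. *)
  apply: (kernel_relaxation_time_compare (w := fun=> 1)) HUM HU => //.
  - by rewrite coef_gt0 // muln_gt0 IJ2_gt0 k_gt0.
  - by rewrite coef_gt0 // muln_gt0 IJ2_gt0 k_gt0.
  - by move=> x y; rewrite !mul1r /PUM_off minC.
  - by move=> x y; rewrite !mul1r PU_off_sym.
  - exact: PU_off_ge0.
  - exact: PU_PUM_off_bounds.
have mM_gt0 k : (0 < k)%N -> 0 < ((I * J) ^ 2 * k ^ 4)%:R / (n ^ 2)%:R :> R.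
  by move=> k0; rewrite coef_gt0 // muln_gt0 IJ2_gt0 k_gt0.
(* For (b) this bounds [tFYM] by multiples of [tFY]; inverting the constants gives the stated
   form. *)
have [lo up] := kernel_relaxation_time_compare Hcard (@piFY_gt0 _ _ _ _ _ R)
  (mM_gt0 _ m_gt0) (mM_gt0 _ M_gt0) (@PFY_off_reversible _ _ _ _ _ R)
  (@PFYM_off_reversible _ _ _ _ _ R)
  (@PFYM_off_ge0 _ _ _ _ _ R) (PFYM_PFY_off_bounds R lam_le Hcard) HFY HFYM.
by split; rewrite -[X in X * _]invf_div (ler_pdivrMl, ler_pdivlMl) ?mM_gt0.
Qed.
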